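(* Let $U,\hat U$ be Hilbert spaces and $Q:U\to\hat U$ a bounded linear operator. Consider an admissible iteration (associated with $Q$), let $(w,u^{(0)})\in\hat U\times U$, let $(u^{(n)})_{n\ge0}$ be the iterates it generates from $(w,u^{(0)})$, and assume that the residuals $r^{(n)}=Q^*(Qu^{(n)}-w)$ converge to zero in norm. (i) If $(u^{(n)})_{n\ge0}$ converges in norm, then $\lim_{n\to\infty}u^{(n)}=P_{M_{Q,w}}u^{(0)}$. (ii) If $M_{Q,w}=\emptyset$, then $\lim_{n\to\infty}\|u^{(n)}\|=\infty$.
   Context: $Q^*$ is the adjoint of $Q$ and $\operatorname{ran}$ denotes range. $M_{Q,w}:=\{u\in U:\|Qu-w\|=\inf_{v\in U}\|Qv-w\|\}$; $P_S$ is the orthogonal projection onto a nonempty closed affine subspace $S$ (in (i) the claim includes that $M_{Q,w}$ is nonempty). An admissible iteration is specified by a sequence of sets $(\mathscr S_n)_{n\ge0}$ (state spaces) with $\mathscr S_0=\{0\}$ and a sequence of mappings $J_n:(\operatorname{ran}(Q^* )\setminus\{0\})\times\mathscr S_n\to\operatorname{ran}(Q^* )\times\mathscr S_{n+1}$, $n\ge0$. Given $(w,u^{(0)})\in\hat U\times U$ and $s^{(0)}=0$, it generates, for $n\ge0$, $r^{(n)}=Q^*(Qu^{(n)}-w)$, $(d^{(n)},s^{(n+1)})=J_n(r^{(n)},s^{(n)})$, $u^{(n+1)}=u^{(n)}+d^{(n)}$. The iteration is terminated as soon as $r^{(n)}=0$, in which case the sequence is regarded as constant from then on ($u^{(m)}=u^{(n)}$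 and $r^{(m)}=0$ for $m\ge n$). *)

(* Defs.v *)
From HB Require Import structures.
From mathcomp Require Import all_boot all_order all_algebra.
From mathcomp Require Import complex.
From mathcomp Require Import all_classical all_reals all_analysis.

Set Implicit Arguments.
Unset Strict Implicit.
Unset Printing Implicit Defensive.

Import Order.TTheory GRing.Theory Num.Theory.
Import numFieldNormedType.Exports.

Local Open Scope classical_set_scope.
Local Open Scope ring_scope.

(* The scalars of a Hilbert space are either R or C = R[i], where R : realType
   is the field of real numbers. *)
Variant scalar_kind := RealScalars | ComplexScalars.

Definition scalars (R : realType) (k : scalar_kind) : numFieldType :=
  match k with
  | RealScalars => R
  | ComplexScalars => R[i]%C
  end.

Definition scalar_conj (R : realType) (k : scalar_kind) :
    involutive_rmorphism (scalars R k) :=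
  match k with
  | RealScalars => idfun
  | ComplexScalars => @Num.conj R[i]%C
  end.

(* A complete normed module whose norm comes from a theta-sesquilinear inner
   product, linear in its first argument. In normed modules over R[i] the norm
   takes its values in R[i] (they are nonnegative reals), and z1 <= z2 in R[i]
   means that z2 - z1 is a nonnegative real. *)
HB.mixin Record CompleteNormedModule_isHilbert
    (K : numFieldType) (theta : K -> K) (U : Type)
    & CompleteNormedModule K U := {
  dotp : {dot U for theta} ;
  sqr_norm_dotp : forall u : U, `|u| ^+ 2 = dotp u u
}.

#[short(type="hilbertType")]
HB.structure Definition Hilbert (K : numFieldType) (theta : K -> K) :=
  {U of CompleteNormedModule K U & CompleteNormedModule_isHilbert K theta U}.

Section hilbert_notions.
Context (K : numFieldType) (theta : K -> K) (U V : hilbertType theta).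

(* Over R or C, the set below is a singleton (Riesz) when Q is
   linear and bounded. *)
Definition adjoint (Q : U -> V) (w : V) : U :=
  xget 0 [set v | forall u, dotp (Q u) w = dotp u v].

(* Over R or C, the set below is a singleton when S is a nonempty closed affine
   subspace. *)
Definition orth_proj (S : set U) (x : U) : U :=
  xget 0 [set p | S p /\ forall v, S v -> dotp (x - p) (v - p) = 0].

(* The infimum, in the order of K, of a nonempty set of norms; 0 is only the
   default value of `infimum`. *)
Definition least_squares_solutions (Q : U -> V) (w : V) : set U :=
  [set u | `|Q u - w| = infimum 0 (range (fun v => `|Q v - w|))].

(* All state spaces are subsets of one ambient type, and the maps J_n are total
   functions of which only the restriction to the stated domain matters.
   `init_state` is the single element of the initial state space. *)
Record admissible_iteration (Q : U -> V) := AdmissibleIteration {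
  state : Type ;
  init_state : state ;
  state_space : nat -> set state ;
  step : nat -> U * state -> U * state ;
  state_space0 : state_space 0%N = [set init_state] ;
  step_fun : forall n,
    set_fun ((range (adjoint Q) `\ 0) `*` state_space n)
            (range (adjoint Q) `*` state_space n.+1)
            (step n)
}.

Definition residual (Q : U -> V) (w : V) (u : U) : U := adjoint Q (Q u - w).

Section generated_sequence.
Context (Q : U -> V) (A : admissible_iteration Q) (w : V) (u0 : U).

(* The pair (u^(n), s^(n)); it stays constant once the residual vanishes. *)
Fixpoint trajectory (n : nat) : U * state A :=
  match n with
  | 0%N => (u0, init_state A)
  | m.+1 =>
    let: (u, s) := trajectory m in
    let r := residual Q w u in
    if r == 0 then (u, s)
    else let: (d, s') := step m (r, s) in (u + d, s')
  end.

Definition iterate (n : nat) : U := (trajectory n).1.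

End generated_sequence.
End hilbert_notions.

(* Main.v *)
(** The steps lie in ran Q*, which is orthogonal to ker Q, so a limit u of the
    iterates satisfies the normal equation together with u - u0 _|_ ker Q, and
    M_{Q,w} = u + ker Q; hence u is the projection of u0.

    If the norms do not tend to infinity, a subsequence of the iterates is
    bounded.  Instead of extracting a weak limit, take near-minimisers of the
    norm in the nested convex sets C_k = {u : |Q*(Qu - w)| <= 1/(k+1)}: the
    minimal norms are nondecreasing and bounded, so by the parallelogram identity
    the near-minimisers form a Cauchy sequence, and their limit solves the normal
    equation.  The same argument, for a constant sequence of sets, gives the Riesz
    representation needed for the existence of Q*. *)
Require Import Defs.
From HB Require Import structures.
From mathcomp Require Import all_boot all_order all_algebra.
From mathcomp Require Import complex ring.
From mathcomp Require Import all_classical all_reals all_analysis.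

Set Implicit Arguments.
Unset Strict Implicit.
Unset Printing Implicit Defensive.

Import Order.TTheory GRing.Theory Num.Theory.
Import numFieldNormedType.Exports.
Local Open Scope classical_set_scope.
Local Open Scope ring_scope.

(* The order completeness of R in a form that also holds for R[i], where only
   the real elements are comparable. *)
Definition has_nonneg_infima (K : numFieldType) := forall A : set K,
  A !=set0 -> (forall a, A a -> 0 <= a) ->
  exists i, [/\ 0 <= i, lbound A i &
    forall e, 0 < e -> exists2 a, A a & a < i + e].

Lemma real_has_nonneg_infima (R : realType) : has_nonneg_infima R.
Proof.
move=> A A0 Age0.
have lbA : has_lbound A by exists 0 => a /Age0.
exists (inf A); split.
- exact: lb_le_inf.
- by move=> a Aa; apply: ge_inf.
- by move=> e e0; apply: inf_adherent.
Qed.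

(** Nonnegative elements of [R[i]] are real, so the claim transfers along the real part. *)
Lemma complex_has_nonneg_infima (R : realType) : has_nonneg_infima R[i]%C.
Proof.
move=> A [a0 Aa0] Age0.
have ReK a : A a -> (complex.Re a)%:C%C = a.
  by move=> /Age0 a_ge0; apply: RRe_real; apply: ger0_real.
have [|b [a Aa <-]|i [i0 ilb iadh]] :=
    @real_has_nonneg_infima R ((@complex.Re R) @` A).
- by exists (complex.Re a0), a0.
- by rewrite -lecR ReK ?Age0.
exists (i%:C)%C; split.
- by rewrite lecR.
- by move=> a Aa; rewrite -(ReK _ Aa) lecR; apply: ilb; exists a.
- move=> e e0; have eE : (complex.Re e)%:C%C = e.
    by apply: RRe_real; apply: gtr0_real.
  have [|b [a Aa <-] lt_a] := iadh (complex.Re e).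
    by rewrite -ltcR eE.
  by exists a => //; rewrite -(ReK _ Aa) -eE -rmorphD ltcR.
Qed.

Lemma scalars_has_nonneg_infima (R : realType) (k : scalar_kind) :
  has_nonneg_infima (scalars R k).
Proof.
case: k; [exact: real_has_nonneg_infima|exact: complex_has_nonneg_infima].
Qed.

(** The infimum [i] of the numbers 1/(n+1) is also at most each 1/(2(n+1)), so 2i <= i and [i] is
    0. *)
Lemma nonneg_infima_archi (K : numFieldType) : has_nonneg_infima K ->
  forall e : K, 0 < e -> exists n, n.+1%:R^-1 < e.
Proof.
move=> Kinf e e0.
have [||i [i0 ilb iadh]] := Kinf (range (fun n => n.+1%:R^-1 : K)).
- by exists 1^-1, 0%N.
- by move=> _ [n _ <-]; rewrite invr_ge0.
have ii : i + i <= i.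
  apply/ler_addgt0Pr => d /iadh[_ [n _ <-]] /ltW; apply: le_trans.
  have : i <= (2 * n.+1)%:R^-1.
    by apply: ilb; exists (2 * n).+1 => //; rewrite mulnS.
  rewrite natrM invfM => le_i; rewrite -[leRHS](divfK (_ : 2%:R != 0)) ?pnatr_eq0//.
  by rewrite [leRHS]mulrDr mulr1 [_^-1 / _]mulrC lerD.
have [_ [n _ <-]] := iadh _ e0; exists n.
have i_le0 : i <= 0 by rewrite -(lerD2l i) addr0.
by rewrite -[ltRHS]add0r; have <- : i = 0 by apply/le_anti; rewrite i_le0.
Qed.

(** * Inner product identities and the Cauchy-Schwarz inequality *)

Section inner_product.
Context (K : numFieldType) (theta : involutive_rmorphism K) (U : hilbertType theta).
Implicit Types (u v w : U) (a : K).

Lemma dotpC u v : dotp u v = theta (dotp v u).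
Proof. by rewrite hermC mul1r. Qed.

Lemma dotpDl u v w : dotp (u + v) w = dotp u w + dotp v w.
Proof. exact: linearDl. Qed.

Lemma dotpBl u v w : dotp (u - v) w = dotp u w - dotp v w.
Proof. exact: linearBl. Qed.

Lemma dotpDr u v w : dotp w (u + v) = dotp w u + dotp w v.
Proof. exact: linearDr. Qed.

Lemma dotpBr u v w : dotp w (u - v) = dotp w u - dotp w v.
Proof. exact: linearBr. Qed.

Lemma dotpNl u v : dotp (- u) v = - dotp u v.
Proof. exact: linearNl. Qed.

Lemma dotpNr u v : dotp u (- v) = - dotp u v.
Proof. exact: linearNr. Qed.

Lemma dotpZl a u v : dotp (a *: u) v = a * dotp u v.
Proof. exact: linearZl_LR. Qed.

Lemma dotpZr a u v : dotp u (a *: v) = theta a * dotp u v.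
Proof. by rewrite dotpC dotpZl rmorphM /= [dotp u v]dotpC. Qed.

Lemma dotp_eq0C u v : dotp u v = 0 -> dotp v u = 0.
Proof. by move=> uv0; rewrite dotpC uv0 rmorph0. Qed.

Lemma eq_dotpr v w : (forall u, dotp u v = dotp u w) -> v = w.
Proof.
move=> vw; apply/eqP; rewrite -subr_eq0 -normr_eq0 -sqrf_eq0 sqr_norm_dotp.
by rewrite dotpBr vw subrr.
Qed.

(** Computing |au|^2 by homogeneity and by sesquilinearity ties [theta] to the absolute value, given
    a nonzero vector. *)
Lemma sqr_norm_conj a u : u != 0 -> `|a| ^+ 2 = a * theta a.
Proof.
move=> u0; apply: (@mulIf _ (`|u| ^+ 2)); first by rewrite sqrf_eq0 normr_eq0.
by rewrite -exprMn -normrZ !sqr_norm_dotp dotpZl dotpZr mulrA.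
Qed.

Lemma parallelogram u v :
  `|u - v| ^+ 2 = 2 * `|u| ^+ 2 + 2 * `|v| ^+ 2 - `|u + v| ^+ 2.
Proof. by rewrite !sqr_norm_dotp !(dotpBl, dotpBr, dotpDl, dotpDr); ring. Qed.

Lemma pythagoras u v : dotp u v = 0 -> `|u + v| ^+ 2 = `|u| ^+ 2 + `|v| ^+ 2.
Proof.
move=> uv0; rewrite !sqr_norm_dotp dotpDl !dotpDr uv0 (dotp_eq0C uv0).
by rewrite addr0 add0r.
Qed.

(** The vector subtracted is the projection of [u] on the line of [v]. The identity serves both
    Cauchy-Schwarz and the Riesz argument. *)
Lemma sqr_norm_sub_proj u v : v != 0 ->
  `|u - (dotp u v / `|v| ^+ 2) *: v| ^+ 2 = `|u| ^+ 2 - `|dotp u v| ^+ 2 / `|v| ^+ 2.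
Proof.
move=> v0; rewrite (sqr_norm_conj _ v0) !sqr_norm_dotp.
have : dotp v v != 0 by rewrite -sqr_norm_dotp sqrf_eq0 normr_eq0.
rewrite !(dotpBl, dotpBr, dotpZl, dotpZr) rmorphM fmorphV /= -!dotpC => vv0.
by field.
Qed.

Lemma cauchy_schwarz u v : `|dotp u v| <= `|u| * `|v|.
Proof.
have [->|v0] := eqVneq v 0; first by rewrite linear0r !normr0 mulr0.
rewrite -(@ler_pXn2r _ 2) ?nnegrE ?mulr_ge0// exprMn.
have v_gt0 : 0 < `|v| ^+ 2 by rewrite exprn_gt0 ?normr_gt0.
rewrite -ler_pdivrMr// -subr_ge0 -(sqr_norm_sub_proj _ v0).
by rewrite exprn_ge0.
Qed.

Lemma cvg_dotpl (x : U ^nat) l v :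
  x @ \oo --> l -> (fun n => dotp (x n) v) @ \oo --> dotp l v.
Proof.
move=> xl; apply/cvgrPdist_lt => e e0.
have v1 : 0 < `|v| + 1 by rewrite ltr_wpDl.
have [N _ xN] := (cvgrPdist_lt _ _).1 xl (e / (`|v| + 1)) (divr_gt0 e0 v1).
exists N => // n /xN lt_n; rewrite -dotpBl.
apply: le_lt_trans (cauchy_schwarz _ _) _.
apply: le_lt_trans (_ : `|l - x n| * (`|v| + 1) < e).
  by rewrite ler_wpM2l// lerDl.
by rewrite -ltr_pdivlMr.
Qed.

Lemma cvg_dotp_uniq (x : U ^nat) l v a :
  x @ \oo --> l -> (fun n => dotp (x n) v) @ \oo --> a -> dotp l v = a.
Proof. by move=> /(@cvg_dotpl _ _ v); apply: cvg_unique; apply: norm_hausdorff. Qed.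

(** * Nearly minimal norms in nested sets *)

Context (Kinf : has_nonneg_infima K).

(** The sets may fail to be closed and [l] may lie outside them; properties of [l] are recovered
    along [p]. *)
Lemma nested_near_minimizers (C : nat -> set U) (M : K) :
  (forall m n, (m <= n)%N -> C n `<=` C m) ->
  (forall n u v, C n u -> C n v -> C n (2^-1 *: (u + v))) ->
  (forall n, exists2 u, C n u & `|u| ^+ 2 <= M) ->
  exists p : U ^nat, exists l : U, [/\ forall n, C n (p n), p @ \oo --> l &
    forall u, (forall n, C n u) -> `|l| ^+ 2 <= `|u| ^+ 2].
Proof.
move=> Cnest Cmid CM.
have /choice[i iP] n : exists i : K,
    [/\ i <= M, forall u, C n u -> i <= `|u| ^+ 2 &
    forall e, 0 < e -> exists2 u, C n u & `|u| ^+ 2 < i + e].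
  have [||i [i0 ilb iadh]] := @Kinf ((fun u : U => `|u| ^+ 2) @` C n).
  - by have [u Cu _] := CM n; exists (`|u| ^+ 2), u.
  - by move=> _ [u _ <-]; rewrite exprn_ge0.
  exists i; split.
  - by have [u Cu] := CM n; apply: le_trans; apply: ilb; exists u.
  - by move=> u Cu; apply: ilb; exists u.
  - by move=> e /iadh[_ [u Cu <-] lt_u]; exists u.
have i_mono m n : (m <= n)%N -> i m <= i n.
  move=> mn; apply/ler_addgt0Pr => e e0.
  have [_ ilb _] := iP m; have [_ _ iadh] := iP n.
  have [u Cu /ltW] := iadh e e0; apply: le_trans.
  by apply: ilb; apply: Cnest Cu.
have /choice[p pP] n : exists u, C n u /\ `|u| ^+ 2 < i n + n.+1%:R^-1.
  have [_ _ iadh] := iP n.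
  by have [|u Cu lt_u] := iadh (n.+1%:R^-1); [rewrite invr_gt0|exists u].
(* The infimum of the nonnegative numbers [M - i n] replaces the limit of the bounded nondecreasing
   [i]. *)
have i_cauchy e : 0 < e -> exists N, forall n, (N <= n)%N -> i n - i N < e.
  move=> e0; have [||j [j0 jlb jadh]] := @Kinf (range (fun n => M - i n)).
  - by exists (M - i 0%N), 0%N.
  - by move=> _ [n _ <-]; rewrite subr_ge0; have [] := iP n.
  have [_ [N _ <-] lt_N] := jadh e e0; exists N => n Nn.
  have : j <= M - i n by apply: jlb; exists n.
  rewrite -(lerD2r e) => /(lt_le_trans lt_N).
  by rewrite -ltrBlDl; congr (_ < _); ring.
have inv_le (m n : nat) : (m <= n)%N -> n.+1%:R^-1 <= m.+1%:R^-1 :> K.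
  by move=> mn; rewrite lef_pV2 ?posrE// ler_nat ltnS.
have p_cauchy (e : K) : 0 < e ->
    exists N, forall n, (N <= n)%N -> `|p N - p n| < e.
  (* In the parallelogram identity, |p N|^2 < i N + d and |p n|^2 < i N + 2d count twice each, and
     |p N + p n|^2 is at least 4 i N: the total error is 6d. *)
  move=> e0; pose d : K := e ^+ 2 / 6%:R.
  have d0 : 0 < d by rewrite divr_gt0// exprn_gt0.
  have [N1 iN1] := i_cauchy _ d0.
  have [N2 archN2] := nonneg_infima_archi Kinf d0.
  pose N := maxn N1 N2; exists N => n Nn.
  rewrite -(@ltr_pXn2r _ 2) ?nnegrE ?(ltW e0)//.
  have [Cn pn] := pP n; have [CN pN] := pP N.
  have [_ ilb _] := iP N.
  have /ilb := Cmid N _ _ CN (Cnest _ _ Nn _ Cn).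
  rewrite normrZ exprMn normfV normr_nat => le_mid.
  have in_N1 : i n - i N < d.
    apply: le_lt_trans (iN1 n (leq_trans (leq_maxl _ _) Nn)).
    by rewrite lerD2l lerN2 i_mono// leq_maxl.
  have invN : N.+1%:R^-1 < d :> K.
    by apply: le_lt_trans archN2; apply: inv_le; apply: leq_maxr.
  have invn := le_lt_trans (inv_le _ _ Nn) invN.
  rewrite parallelogram.
  have -> : e ^+ 2 = 2 * (i N + d) + 2 * ((d + i N) + d) - 2 ^+ 2 * i N.
    by rewrite /d; field.
  apply: ltr_leD.
    apply: ltrD; rewrite ltr_pM2l//.
      by apply: lt_trans pN _; rewrite ltrD2l.
    by apply: lt_trans pn _; rewrite ltrD// -ltrBlDr.
  by rewrite lerN2 -ler_pdivlMl ?exprn_gt0// -exprVn.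
have [l pl] : exists l : U, p @ \oo --> l.
  suff : cvg (p @ \oo) by move=> ?; exists (lim (p @ \oo)).
  apply: cauchy_cvg; apply: cauchy_exP => e e0.
  have [N pN] := p_cauchy e e0; exists (p N), N => // n /= Nn.
  by rewrite -ball_normE; apply: pN.
exists p, l; split => // [n|u Cu]; first by have [] := pP n.
apply/ler_addgt0Pr => e e0.
have e2 : 0 < e / 2 by rewrite divr_gt0.
have pl2 : (fun n => `|p n| ^+ 2 : K) @ \oo --> `|l| ^+ 2.
  by under eq_fun do rewrite expr2; rewrite expr2; apply: cvgM; apply: cvg_norm.
have [N1 _ pN1] := (cvgrPdist_lt _ _).1 pl2 (e / 2) e2.
have [N2 archN2] := nonneg_infima_archi Kinf e2.
pose n := maxn N1 N2.
have [Cn pn] := pP n; have [_ ilb _] := iP n.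
have reals (v : U) : `|v| ^+ 2 \is Num.real by rewrite rpredX// normr_real.
have le1 : `|l| ^+ 2 - `|p n| ^+ 2 <= e / 2.
  apply: le_trans (ltW (pN1 n (leq_maxl _ _))).
  by rewrite real_ler_norm// realB.
have le2 : `|p n| ^+ 2 <= `|u| ^+ 2 + e / 2.
  apply: le_trans (ltW pn) _; apply: lerD; first exact: ilb.
  by apply: le_trans (ltW archN2); apply: inv_le; apply: leq_maxr.
have := lerD le1 le2; rewrite subrK => /le_trans; apply.
by rewrite addrCA -splitr.
Qed.

End inner_product.

(** * Adjoint, normal equation and least squares *)

Section normal_equation.
Context (K : numFieldType) (theta : involutive_rmorphism K).
Context (U V : hilbertType theta) (Q : {linear U -> V}).
Context (Kinf : has_nonneg_infima K) (Qcont : continuous Q).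
Implicit Types (u v : U) (w : V).

Lemma cvg_linear (x : U ^nat) l : x @ \oo --> l -> (Q \o x) @ \oo --> Q l.
Proof. by move=> xl; apply: continuous_cvg => //; apply: Qcont. Qed.

(** The least-norm element [l] of the hyperplane where the functional is 1 is orthogonal to its
    kernel; a rescaling of [l] represents the functional. *)
Lemma riesz_adjoint w : exists v, forall u, dotp (Q u) w = dotp u v.
Proof.
have [f0|/existsNP[u0 /eqP f0]] := pselect (forall u, dotp (Q u) w = 0).
  by exists 0 => u; rewrite f0 linear0r.
pose a := (dotp (Q u0) w)^-1 *: u0.
have fa : dotp (Q a) w = 1 by rewrite linearZ dotpZl mulVf.
have [|n u v fu fv|_|p [l [Cp pl lmin]]] :=
  @nested_near_minimizers K theta U Kinf
    (fun=> [set u | dotp (Q u) w = 1]) (`|a| ^+ 2).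
- by move=> m n _ z.
- by rewrite /= linearZ dotpZl linearD dotpDl fu fv mulVf// pnatr_eq0.
- by exists a.
have fl : dotp (Q l) w = 1.
  apply: (cvg_dotp_uniq (cvg_linear pl)).
  by under eq_fun do rewrite /= Cp; apply: cvg_cst.
have l0 : l != 0.
  apply/eqP => l0; move: fl; rewrite l0 linear0 linear0l => /eqP.
  by rewrite eq_sym oner_eq0.
have ll : 0 < `|l| ^+ 2 by rewrite exprn_gt0 ?normr_gt0.
(* Removing from [l] its projection on [z] stays in the hyperplane, so minimality forces that
   projection to vanish. *)
have ker z : dotp (Q z) w = 0 -> dotp z l = 0.
  move=> fz; have [->|z0] := eqVneq z 0; first exact: linear0l.
  apply: dotp_eq0C; apply/eqP; rewrite -normr_eq0 -sqrf_eq0 eq_le exprn_ge0// andbT.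
  have zz : 0 < `|z| ^+ 2 by rewrite exprn_gt0 ?normr_gt0.
  rewrite -(pmulr_lle0 _ (_ : 0 < (`|z| ^+ 2)^-1)) ?invr_gt0//.
  rewrite -oppr_ge0 -(lerDl (`|l| ^+ 2)) -sqr_norm_sub_proj//.
  by apply: lmin => _ /=; rewrite linearB linearZ dotpBl dotpZl fz mulr0 subr0.
exists ((`|l| ^+ 2)^-1 *: l) => u.
have /ker/eqP : dotp (Q (u - dotp (Q u) w *: l)) w = 0.
  by rewrite linearB dotpBl linearZ dotpZl fl mulr1 subrr.
rewrite dotpBl dotpZl subr_eq0 => /eqP ul.
(* [theta] fixes |l|^2, which is [dotp l l]. *)
rewrite dotpZr ul -sqr_norm_dotp fmorphV /= [X in theta X]sqr_norm_dotp -dotpC.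
by rewrite -sqr_norm_dotp mulrCA mulVf ?mulr1 ?gt_eqF.
Qed.

Lemma dotp_adjoint u w : dotp (Q u) w = dotp u (adjoint Q w).
Proof. by move: u; apply: (xgetPex 0 (riesz_adjoint w)). Qed.

Lemma dotp_residual u v w : dotp v (residual Q w u) = dotp (Q v) (Q u - w).
Proof. by rewrite dotp_adjoint. Qed.

(** [adjoint] is a chosen value, so the identity is checked by pairing with every vector. *)
Lemma residual_midpoint u v w :
  residual Q w (2^-1 *: (u + v)) = 2^-1 *: (residual Q w u + residual Q w v).
Proof.
apply: eq_dotpr => x; rewrite dotp_residual dotpZr dotpDr !dotp_residual.
rewrite -dotpDr -dotpZr; congr (dotp _ _).
rewrite linearZ linearD addrACA -opprD scalerBr; congr (_ - _).
by rewrite -mulr2n -[w *+ 2]scaler_nat scalerA mulVf ?scale1r// pnatr_eq0.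
Qed.

Definition normal_equation w u := forall v, dotp (Q v) (Q u - w) = 0.

Lemma normal_equation_lim (x : U ^nat) l w : x @ \oo --> l ->
  (fun n => residual Q w (x n)) @ \oo --> (0 : U) -> normal_equation w l.
Proof.
move=> xl r0 v; apply: dotp_eq0C.
have Qxl : (fun n => Q (x n) - w) @ \oo --> Q l - w.
  by apply: cvgB (cvg_linear xl) _; apply: cvg_cst.
apply: (cvg_dotp_uniq Qxl).
have -> : (fun n => dotp (Q (x n) - w) (Q v)) =
    fun n => dotp (residual Q w (x n)) v.
  by apply/funext => n; rewrite dotpC [RHS]dotpC dotp_residual.
by rewrite -(linear0l dotp v); apply: cvg_dotpl.
Qed.

Lemma sqr_norm_normal_equation u v w : normal_equation w u ->
  `|Q v - w| ^+ 2 = `|Q (v - u)| ^+ 2 + `|Q u - w| ^+ 2.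
Proof. by move=> /(_ (v - u)) /pythagoras <-; rewrite linearB addrA subrK. Qed.

(** By Pythagoras [u] attains the minimum, and [v] does so exactly when the extra term |Q(v - u)|^2
    vanishes. *)
Lemma least_squares_solutionsE u w : normal_equation w u ->
  least_squares_solutions Q w = [set v | Q (v - u) = 0].
Proof.
move=> normal; have min_u v : `|Q u - w| <= `|Q v - w|.
  rewrite -(@ler_pXn2r _ 2) ?nnegrE// (sqr_norm_normal_equation v normal).
  by rewrite lerDr exprn_ge0.
(* [infimum] is a chosen value with a default on the empty set; the range is nonempty, and
   antisymmetry identifies the choice with the minimum. *)
have infE : infimum 0 (range (fun v => `|Q v - w|)) = `|Q u - w|.
  rewrite /infimum ifF; last by apply/negbTE/set0P; exists `|Q u - w|, u.
  have inf_u : infimums (range (fun v => `|Q v - w|)) `|Q u - w|.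
    by split => [_ [v _ <-]|y]; [|apply; exists u].
  have [inf_l inf_g] := xgetI 0 inf_u.
  by apply/le_anti/andP; split; [apply: inf_l; exists u | apply: inf_g; case: inf_u].
apply/seteqP; split => v; rewrite /least_squares_solutions /= infE.
- move=> /(congr1 (fun a => a ^+ 2)); rewrite (sqr_norm_normal_equation v normal).
  rewrite -[RHS]add0r => /addIr /eqP; rewrite sqrf_eq0 normr_eq0 => /eqP; exact.
- by rewrite linearB => /eqP; rewrite subr_eq0 => /eqP ->.
Qed.

Lemma orth_proj_least_squares u u0 w : normal_equation w u ->
  (forall z, Q z = 0 -> dotp (u - u0) z = 0) ->
  orth_proj (least_squares_solutions Q w) u0 = u.
Proof.
move=> normal ker_orth; rewrite (least_squares_solutionsE normal).
apply: xget_subset1.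
  split => [|v /ker_orth uv0]; first by rewrite /= subrr linear0.
  by rewrite -[u0 - u]opprB dotpNl uv0 oppr0.
move=> p q [Sp orth_p] [Sq orth_q].
apply/eqP; rewrite -subr_eq0 -normr_eq0 -sqrf_eq0 sqr_norm_dotp.
(* Uniqueness: each of two candidate projections is tested against the other. *)
have -> : dotp (p - q) (p - q) = dotp (u0 - q) (p - q) + dotp (u0 - p) (q - p).
  rewrite -[q - p]opprB dotpNr -dotpBl; congr (dotp _ _).
  by rewrite opprB [RHS]addrC subrKA.
by rewrite orth_p// orth_q// addr0.
Qed.

(** A late iterate of norm at most [M] lies in each [C k]; since [M] does not depend on [k], the
    minimal norms stay bounded. *)
Lemma bounded_residual_subseq (x : U ^nat) (M : K) w :
  (fun n => residual Q w (x n)) @ \oo --> (0 : U) ->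
  (forall N, exists2 n, (N <= n)%N & `|x n| <= M) ->
  exists u, normal_equation w u.
Proof.
move=> r0 xM.
pose C k := [set u | `|residual Q w u| <= k.+1%:R^-1].
have M0 : 0 <= M by have [n _] := xM 0%N; apply: le_trans.
have [m n mn u|k u v Cu Cv|k|p [l [Cp pl _]]] :=
  @nested_near_minimizers K theta U Kinf C (M ^+ 2).
- by move=> /le_trans; apply; rewrite lef_pV2 ?posrE// ler_nat ltnS.
- rewrite /C /= residual_midpoint normrZ normfV normr_nat.
  rewrite ler_pdivrMl//; apply: le_trans (ler_normD _ _) _.
  by rewrite mulr_natl mulr2n lerD.
- have k0 : 0 < k.+1%:R^-1 :> K by rewrite invr_gt0.
  have [N _ rN] := (cvgr0Pnorm_lt _).1 r0 _ k0.
  have [n Nn xn] := xM N; exists (x n); first by apply/ltW/rN.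
  by rewrite ler_pXn2r ?nnegrE.
exists l; apply: (normal_equation_lim pl).
apply/cvgr0Pnorm_lt => e /(nonneg_infima_archi Kinf)[N ltN].
exists N => // n /= Nn; apply: le_lt_trans (Cp n) (le_lt_trans _ ltN).
by rewrite lef_pV2 ?posrE// ler_nat ltnS.
Qed.

(** * Orthogonality of [x n - u0] to the kernel of [Q] *)

Section iteration.
Context (A : admissible_iteration Q) (w : V) (u0 : U).
Local Notation x := (iterate A w u0).

(** After termination the state is frozen while [n] advances and may leave [state_space n]; hence
    the alternative. *)
Lemma trajectory_state n :
  residual Q w (x n) = 0 \/ state_space n (trajectory A w u0 n).2.
Proof.
rewrite /iterate; elim: n => [|n IH] /=; first by right; rewrite state_space0.
case: (trajectory A w u0 n) IH => u s /= IH.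
case: eqP => [|/eqP r0]; first by left.
case: IH => [/eqP|ss]; first by rewrite (negbTE r0).
have [] := @step_fun _ _ _ _ _ A n (residual Q w u, s).
  by split => //; split; [exists (Q u - w)|apply/eqP].
by case: (step n _) => d s' _ /= ?; right.
Qed.

Lemma iterate_step n : exists y, x n.+1 - x n = adjoint Q y.
Proof.
have := trajectory_state n; rewrite /iterate /=.
(* This covers the zero displacement after termination. *)
have zero : exists y, (0 : U) = adjoint Q y.
  by exists 0; apply: eq_dotpr => v; rewrite -dotp_adjoint !linear0r.
case: (trajectory A w u0 n) => u s /= IH.
case: eqP => [_|/eqP r0]; first by rewrite subrr.
case: IH => [/eqP|ss]; first by rewrite (negbTE r0).
have [] := @step_fun _ _ _ _ _ A n (residual Q w u, s).
  by split => //; split; [exists (Q u - w)|apply/eqP].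
case: (step n _) => d s' /= [y _ <-] _; exists y.
by rewrite addrAC subrr add0r.
Qed.

Lemma iterate_ker_orth n z : Q z = 0 -> dotp (x n - u0) z = 0.
Proof.
move=> Qz0; elim: n => [|n IH]; first by rewrite subrr linear0l.
have [y xy] := iterate_step n.
rewrite -(subrKA (x n)) dotpDl IH addr0 xy; apply: dotp_eq0C.
by rewrite -dotp_adjoint Qz0 linear0l.
Qed.

End iteration.
End normal_equation.

Theorem proposition3p2 (R : realType) (k : scalar_kind)
    (U V : hilbertType (scalar_conj R k))
    (Q : {linear U -> V}) (Q_bounded : bounded_near Q (nbhs (0 : U)))
    (A : admissible_iteration Q) (w : V) (u0 : U)
    (residual_cvg0 :
      (fun n : nat => residual Q w (iterate A w u0 n)) @ \oo --> (0 : U)) :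
  (cvg (iterate A w u0 @ \oo) ->
    least_squares_solutions Q w !=set0 /\
    iterate A w u0 @ \oo --> orth_proj (least_squares_solutions Q w) u0) /\
  (least_squares_solutions Q w = set0 ->
    (fun n : nat => `|iterate A w u0 n|) @ \oo --> +oo).
Proof.
have Kinf := @scalars_has_nonneg_infima R k.
have Qcont : continuous Q by apply/linear_bounded_continuous.
have normal_solution u : normal_equation Q w u -> least_squares_solutions Q w u.
  by move=> /least_squares_solutionsE ->; rewrite /= subrr linear0.
split => [cvg_x|no_solution].
  have normal := normal_equation_lim Kinf Qcont cvg_x residual_cvg0.
  split; first by exists (lim (iterate A w u0 @ \oo)); apply: normal_solution.
  rewrite (orth_proj_least_squares normal)// => z Qz0.
  have cvg_xu0 : (fun n => iterate A w u0 n - u0) @ \oo -->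
      lim (iterate A w u0 @ \oo) - u0.
    by apply: cvgB cvg_x _; apply: cvg_cst.
  apply: (cvg_dotp_uniq cvg_xu0).
  by under eq_fun do rewrite (iterate_ker_orth Kinf Qcont _ _ _ _ Qz0); apply: cvg_cst.
(* Without divergence, some [M] bounds the norms of iterates of arbitrarily large index. *)
apply/cvgryPgtr => M Mreal; apply: contrapT => not_above.
have [N|u /normal_solution] :=
  bounded_residual_subseq Kinf Qcont (M := M) residual_cvg0; last by rewrite no_solution.
apply: contrapT => no_n; apply: not_above; exists N => // n /= Nn.
rewrite real_ltNge ?normr_real//; apply/negP => le_M.
by apply: no_n; exists n.
Qed.
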